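(* Let $d\ge 2$ and $1\le k\le d-1$ be integers. Then there is a constant $C>0$, depending only on $d$ and $k$ (in particular independent of $q$ and of $f$), such that for every finite field $\mathbb F_q$ with $q$ elements and every function $f:\mathbb F_q^d\to\mathbb C$, $$\|T_kf\|_{L^{d+1}(M_k,d\lambda_k)}\le C\,\|f\|_{L^{\frac{d+1}{k+1}}(\mathbb F_q^d,d\mathbf x)},$$ where $T_k$ is the $k$-plane transform on $\mathbb F_q^d$.
   Context: $\mathbb F_q$ is a finite field with $q$ elements and $\mathbb F_q^d$ is the $d$-dimensional vector space over it, equipped with the normalized counting measure $d\mathbf x$, so that for $1\le p<\infty$ $$\|f\|_{L^p(\mathbb F_q^d,d\mathbf x)}=\Big(q^{-d}\sum_{\mathbf x\in\mathbb F_q^d}|f(\mathbf x)|^p\Big)^{1/p}.$$ A $k$-plane is a $k$-dimensional affine subspace of $\mathbb F_q^d$, and $M_k$ is the set of all $k$-planes in $\mathbb F_q^d$. The set $M_k$ is equipped with the normalized counting measure $\lambda_k$, so that for $g:M_k\to\mathbb C$ and $1\le r<\infty$ $$\|g\|_{L^r(M_k,d\lambda_k)}=\Big(\frac1{|M_k|}\sum_{\omega\in M_k}|g(\omega)|^r\Big)^{1/r},$$ where $|\cdot|$ of a finite set denotes its cardinality. The $k$-plane transform of $f:\mathbb F_q^d\to\mathbb C$ is the function $T_kf:M_k\to\mathbb C$ given by $$T_kf(\omega)=\frac1{|\omega|}\sum_{\mathbf x\in\omega}f(\mathbf x),\qquad \omega\in M_k,$$ where $|\omega|=q^k$. *)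

(* Defs.v *)
From HB Require Import structures.
From mathcomp Require Import all_boot all_order all_algebra.
From mathcomp Require Export boolp reals exp complex.

Set Implicit Arguments.
Unset Strict Implicit.
Unset Printing Implicit Defensive.

Import Order.TTheory GRing.Theory Num.Theory.
Local Open Scope ring_scope.
Local Open Scope complex_scope.

Section KPlanes.
Variables (F : finFieldType) (d k : nat).

Definition is_kplane (w : {set 'rV[F]_d}) : bool :=
  `[< exists (a : 'rV[F]_d) (V : {vspace 'rV[F]_d}),
        (\dim V)%VS = k /\ w = [set a + v | v in V] >].

Definition kplane : Type := {w : {set 'rV[F]_d} | is_kplane w}.

HB.instance Definition _ := Finite.on kplane.

End KPlanes.

(* The L^p norm of a complex function on a finite set [T] with respect to the
   normalized counting measure; [Normc.normc] is the complex modulus as an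
   element of [R]. *)
Definition Lpnorm (R : realType) (T : finType) (p : R) (g : T -> R[i]) : R :=
  powR ((#|T|%:R)^-1 * \sum_(x : T) powR (Normc.normc (g x)) p) p^-1.

Definition kplane_transform (R : realType) (F : finFieldType) (d k : nat)
    (f : 'rV[F]_d -> R[i]) (w : kplane F d k) : R[i] :=
  (#|val w|%:R)^-1 * \sum_(x in val w) f x.

(* Main.v *)
Require Import Defs.
From mathcomp Require Import all_boot all_order all_fingroup all_algebra all_field.
From mathcomp Require Import zify ring lra.
From mathcomp Require Import boolp reals sequences exp complex.

(* With n = d + 1 and alpha = (k + 1) / n, expanding the n-th power turns the
   left-hand side into the sum over n-tuples s of points of N(s) times the
   product of the |f(x)|, where N(s) is the number of k-planes containing s;
   N(s) is comparable to q^((d-k)(k-j)) if s spans a j-plane.  After replacing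
   |f| by h^alpha, with sum h <= 2 and q^-d <= h <= 1, compare h^alpha with a
   weight W on tuples: reading s from left to right, a point x contributes h(x),
   plus q^-r if it lies in the r-plane spanned by the previous points.  The total
   mass of W is at most 3^n.  If s is sorted by decreasing h, then
   N(s) * prod h^alpha <= C q^(k(d-k)) W(s): with u = - log_q h this is the linear
   inequality weighted_sum_le, in which B is the set of positions where the span
   grows, that is, the basis greedily chosen in the order of decreasing h. *)

Set Implicit Arguments.
Unset Strict Implicit.
Unset Printing Implicit Defensive.

Import Order.TTheory GRing.Theory Num.Theory.
Local Open Scope ring_scope.

(** * Affine spans of sequences of points, and the number of k-planes through them *)

Section Incidence.
Variables (F : finFieldType) (d : nat).
Implicit Types (s : seq 'rV[F]_d) (x y : 'rV[F]_d) (D : {vspace 'rV[F]_d}).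

(** The space of directions of the affine span of a nonempty [s], with the first point as origin;
    [s] spans a j-plane when its dimension is j. *)
Definition direction s : {vspace 'rV[F]_d} :=
  span [seq y - head 0 s | y <- s].

Lemma direction1 x : direction [:: x] = 0%VS.
Proof. by apply/eqP; rewrite -subv0; apply/span_subvP => v; rewrite /= subrr inE => /eqP->; apply: mem0v. Qed.

Lemma direction_rcons s x : s != [::] ->
  direction (rcons s x) = (direction s + <[(x - head 0 s)%R]>)%VS.
Proof.
by case: s => // x0 s _; rewrite /direction map_rcons -cats1 span_cat span_seq1.
Qed.

Lemma dimv_add_line D v : \dim (D + <[v]>)%VS = (\dim D + (v \notin D))%N.
Proof.
have [vD|vD] := boolP (v \in D); first by rewrite addn0 (addv_idPl _).
rewrite dimv_disjoint_sum ?dim_vline.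
  by case: eqP vD => // ->; rewrite mem0v.
apply/eqP; rewrite -subv0; apply/subvP => u; rewrite memv_cap => /andP[uD].
case/vlineP => c uE; rewrite memv0 uE scaler_eq0; apply: contraNT vD.
rewrite negb_or => /andP[c0 _].
by rewrite -[v](scalerK c0) -uE memvZ.
Qed.

Lemma dim_direction_rcons s x : s != [::] ->
  \dim (direction (rcons s x)) =
  (\dim (direction s) + (x - head 0 s \notin direction s)%R)%N.
Proof. by move=> s0; rewrite direction_rcons // dimv_add_line. Qed.

Lemma mem_direction s x : x \in s -> x - head 0 s \in direction s.
Proof. by move=> xs; apply/memv_span/map_f. Qed.

Lemma card_affine D x0 : #|[set x | x - x0 \in D]| = (#|F| ^ \dim D)%N.
Proof.
rewrite -card_vspace -[LHS](card_imset _ (addIr (- x0))).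
apply: eq_card => y; apply/imsetP/idP => [[x + ->]|yD]; first by rewrite inE.
by exists (y + x0); rewrite ?inE addrK.
Qed.

Variable k : nat.

Lemma kplane_direction (w : kplane F d k) x0 : x0 \in val w ->
  exists2 D, \dim D = k & forall y, (y \in val w) = (y - x0 \in D).
Proof.
case: w => w /=; rewrite /is_kplane => /asboolP[a [D [dimD ->]]].
case/imsetP => v vD ->; exists D => // y.
apply/imsetP/idP => [[u uD ->]|yD].
  by rewrite opprD addrACA subrr add0r rpredB.
exists (y - a); last by rewrite addrC subrK.
by rewrite -(rpredBr (y - a) vD) -addrA -opprD.
Qed.

Lemma kplane_through D x0 : \dim D = k ->
  exists w : kplane F d k, forall y, (y \in val w) = (y - x0 \in D).
Proof.
move=> dimD.
have kw : is_kplane k [set x0 + v | v in D] by apply/asboolP; exists x0, D.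
exists (Sub _ kw) => y; rewrite SubK; apply/imsetP/idP => [[v vD ->]|yD].
  by rewrite addrC addKr.
by exists (y - x0) => //; rewrite addrC subrK.
Qed.

Definition kplanes_on s : {set kplane F d k} :=
  [set w : kplane F d k | all (mem (val w)) s].

Lemma kplane_on_direction s (w : kplane F d k) : s != [::] ->
  w \in kplanes_on s ->
  exists D, [/\ \dim D = k, (direction s <= D)%VS
              & forall y, (y \in val w) = (y - head 0 s \in D)].
Proof.
move=> s0; rewrite inE => /allP sw.
have hw : head 0 s \in val w by apply: sw; case: s s0 => //= *; apply: mem_head.
have [D dimD wE] := kplane_direction hw.
exists D; split=> //; apply/span_subvP => _ /mapP[y /sw yw ->].
by rewrite -wE.
Qed.

Lemma kplanes_on_eq0 s : s != [::] -> (k < \dim (direction s))%N ->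
  #|kplanes_on s| = 0%N.
Proof.
move=> s0 lt_k; apply/eqP; rewrite cards_eq0; apply/negPn/negP => /set0Pn[w].
case/(kplane_on_direction s0) => D [dimD /dimvS + _].
by rewrite dimD leqNgt lt_k.
Qed.

Lemma kplanes_on_eq1 s : s != [::] -> \dim (direction s) = k ->
  #|kplanes_on s| = 1%N.
Proof.
move=> s0 dims; have [w0 w0E] := kplane_through (head 0 s) dims.
apply/eqP/cards1P; exists w0; apply/setP => w; rewrite in_set1.
apply/idP/eqP => [/(kplane_on_direction s0)[D [dimD sD]]|->].
  have -> : D = direction s by apply/esym/eqP; rewrite eqEdim sD dimD dims /=.
  by move=> wE; apply/val_inj/setP => y; rewrite w0E wE.
by rewrite inE; apply/allP => y /mem_direction; rewrite -w0E.
Qed.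

Lemma kplanes_on_rcons s x (w : kplane F d k) :
  (w \in kplanes_on (rcons s x)) = (x \in val w) && (w \in kplanes_on s).
Proof. by rewrite !inE all_rcons. Qed.

Lemma card_kplane_on (w : kplane F d k) : #|val w| = (#|F| ^ k)%N.
Proof.
case: w => w kw; rewrite SubK; move: (kw); rewrite /is_kplane.
case/asboolP => a [D [dimD wE]].
by rewrite wE card_imset ?card_vspace ?dimD //; apply: addrI.
Qed.

(** Double counting of the pairs of a k-plane [w] containing [s] and a point of [w] off the affine
    span of [s]: [w] has q^k points, and the whole span lies in it. *)
Lemma sum_kplanes_on_rcons s : s != [::] ->
  (\sum_(x | (x - head 0 s)%R \notin direction s) #|kplanes_on (rcons s x)| =
   #|kplanes_on s| * (#|F| ^ k - #|F| ^ \dim (direction s)))%N.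
Proof.
move=> s0.
under eq_bigr do rewrite -sum1_card.
rewrite (exchange_big_dep (mem (kplanes_on s))) /=; last first.
  by move=> x w _; rewrite kplanes_on_rcons => /andP[].
rewrite -sum_nat_const; apply: eq_bigr => w ws.
have [D [dimD sD wE]] := kplane_on_direction s0 ws.
rewrite -(card_affine _ (head 0 s)) -(card_kplane_on w) sum1dep_card.
have aff_w : [set x | x - head 0 s \in direction s] \subset val w.
  by apply/subsetP => x; rewrite inE wE => /(subvP sD).
rewrite -[LHS](addKn #|[set x | x - head 0 s \in direction s]|); congr subn.
rewrite -[RHS](cardsID [set x | x - head 0 s \in direction s]).
congr addn; first by rewrite (setIidPr aff_w).
apply: eq_card => x; rewrite !inE; congr andb.
by rewrite -/(_ \in kplanes_on _) all_rcons; move: ws; rewrite inE => ->; rewrite andbT.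
Qed.

Hypothesis kd : (k <= d)%N.

Lemma card_complement_direction s :
  #|[set x | x - head 0 s \notin direction s]| =
  (#|F| ^ d - #|F| ^ \dim (direction s))%N.
Proof.
have cardV : #|'rV[F]_d| = (#|F| ^ d)%N by rewrite card_mx mul1n.
rewrite -(card_affine _ (head 0 s)) -cardV.
rewrite -(cardsC [set x | x - head 0 s \in direction s]) addKn.
by apply: eq_card => x; rewrite !inE.
Qed.

(** Induction on [m], adding one point off the span at a time. If [s] spans a j-plane, the double
    counting makes N(s) (q^k - q^j) a sum of q^d - q^j terms, and q^d - q^j >= q^(d-k) (q^k -
    q^j). *)
Lemma kplanes_on_lower s m : s != [::] -> (\dim (direction s) + m = k)%N ->
  (#|F| ^ ((d - k) * m) <= #|kplanes_on s|)%N.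
Proof.
have q1 := card_finRing_gt1 F.
elim: m s => [|m IHm] s s0 dims.
  by rewrite muln0 kplanes_on_eq1 // -dims addn0.
set j := \dim _ in dims.
have jk : (#|F| ^ j < #|F| ^ k)%N by rewrite ltn_exp2l //; lia.
rewrite -(leq_pmul2r (m := (#|F| ^ k - #|F| ^ j)%N)) ?subn_gt0 //.
rewrite -sum_kplanes_on_rcons //.
apply: leq_trans (_ : \sum_(x | (x - head 0 s)%R \notin direction s) #|F| ^ ((d - k) * m) <= _)%N.
  rewrite sum_nat_const -cardsE card_complement_direction -/j mulnS expnD.
  rewrite [X in (X <= _)%N]mulnAC mulnBr leq_mul2r; apply/orP; right.
  rewrite -expnD subnK //; apply: leq_sub2l; rewrite -expnD leq_exp2l //; lia.
apply: leq_sum => x xs; apply: IHm; first by rewrite -size_eq0 size_rcons.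
by rewrite dim_direction_rcons // xs -dims -/j; lia.
Qed.

(** The same induction in the other direction: for j < k and q >= 2 one has q^k <= 2 (q^k - q^j),
    which costs a factor 2 at each step. *)
Lemma kplanes_on_upper s m : s != [::] -> (\dim (direction s) + m = k)%N ->
  (#|kplanes_on s| <= (2 * #|F| ^ (d - k)) ^ m)%N.
Proof.
have q1 := card_finRing_gt1 F.
elim: m s => [|m IHm] s s0 dims.
  by rewrite expn0 kplanes_on_eq1 // -dims addn0.
set j := \dim _ in dims.
have jk : (2 * #|F| ^ j <= #|F| ^ k)%N.
  by rewrite -dims addnS expnS leq_mul // leq_exp2l // leq_addr.
have q0 : (0 < #|F| ^ k)%N by rewrite expn_gt0 (ltnW q1).
rewrite -(leq_pmul2r q0).
apply: leq_trans (_ : 2 * (#|kplanes_on s| * (#|F| ^ k - #|F| ^ j)) <= _)%N.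
  by rewrite mulnCA leq_mul2l; apply/orP; right; lia.
rewrite -sum_kplanes_on_rcons // expnS -!mulnA leq_mul2l /=.
rewrite mulnCA -expnD addnC mulnC.
apply: leq_trans (_ : \sum_(x | (x - head 0 s)%R \notin direction s) (2 * #|F| ^ (d - k)) ^ m <= _)%N.
  apply: leq_sum => x xs; apply: IHm; first by rewrite -size_eq0 size_rcons.
  by rewrite dim_direction_rcons // xs -dims -/j; lia.
rewrite sum_nat_const -cardsE card_complement_direction -/j subnKC //.
by rewrite leq_mul2r leq_subr orbT.
Qed.

(** Counting incidences: each k-plane has q^k points, and each of the q^d points lies on at least
    q^((d-k)k) of the k-planes. *)
Lemma card_kplane_lower : (#|F| ^ ((d - k) * k.+1) <= #|{: kplane F d k}|)%N.
Proof.
have q0 : (0 < #|F| ^ k)%N by rewrite expn_gt0 (ltnW (card_finRing_gt1 F)).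
rewrite -(leq_pmul2r q0).
have -> : (#|{: kplane F d k}| * #|F| ^ k = \sum_x #|kplanes_on [:: x]|)%N.
  under [RHS]eq_bigr do rewrite -sum1_card.
  rewrite (exchange_big_dep xpredT) //= -sum_nat_const; apply: eq_bigr => w _.
  rewrite -(card_kplane_on w) -sum1_card; apply: eq_bigl => x.
  by rewrite inE /= !andbT.
apply: leq_trans (_ : \sum_(x : 'rV[F]_d) #|F| ^ ((d - k) * k) <= _)%N.
  rewrite sum_nat_const card_mx mul1n -!expnD leq_exp2l ?card_finRing_gt1 //.
  by rewrite mulnS; lia.
apply: leq_sum => x _; apply: kplanes_on_lower => //.
by rewrite direction1 dimv0.
Qed.

End Incidence.

(** * A linear inequality for exponents, to be applied with [L] = ln q and [u] = - ln h *)

Section WeightedSums.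
Variables (R : realFieldType) (d j : nat) (L : R) (u m : nat -> R).
Variable B : pred nat.
Hypothesis L0 : 0 <= L.
Hypothesis u_ge0 : forall t, (t <= d)%N -> 0 <= u t.
Hypothesis u_le : forall t, (t <= d)%N -> u t <= d%:R * L.
Hypothesis u_mono : forall b t, (b <= t <= d)%N -> u b <= u t.
Hypothesis cardB : (\sum_(t < d.+1) B t = j.+1)%N.
Hypothesis mB : forall t, (t <= d)%N -> B t -> m t = u t.
Hypothesis m_le_u : forall t, (t <= d)%N -> m t <= u t.
Hypothesis m_le_rank : forall t, (t <= d)%N -> ~~ B t ->
  m t + L <= (\sum_(b < t) B b)%N%:R * L.

(* [u b - u t] is nonpositive for [b < t], and at most [d * L] otherwise. *)
Lemma nonbasis_bound t : (t <= d)%N -> ~~ B t ->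
  d.+1%:R * m t + \sum_(b < d.+1 | B b) (u b - u t) <= d.+1%:R * (j%:R * L).
Proof.
move=> td Bt; have td1 := leqW td; set c := (\sum_(b < t) B b)%N.
have splitB : (c + \sum_(t <= b < d.+1) B b = j.+1)%N.
  by rewrite -cardB /c -!(big_mkord xpredT (fun b => B b : nat)) -big_cat_nat.
have cj : (c <= j.+1)%N by rewrite -splitB leq_addr.
have tailB : (\sum_(t <= b < d.+1) B b = j.+1 - c)%N by rewrite -splitB addKn.
have sumB : \sum_(b < d.+1 | B b) (u b - u t) <= (j.+1 - c)%N%:R * (d%:R * L).
  rewrite -(big_mkord (fun b => B b) (fun b => u b - u t)).
  rewrite (@big_cat_nat _ _ _ t) //= -[leRHS]add0r.
  apply: lerD.
    rewrite big_nat_cond; apply: sumr_le0 => b /andP[/andP[_ bt] _].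
    by rewrite subr_le0 u_mono // (ltnW bt) td.
  rewrite -tailB natr_sum mulr_suml big_mkcond /= !big_nat.
  apply: ler_sum => b /andP[_ bd]; case: (B b); last by rewrite mul0r.
  rewrite mul1r; have := u_le bd; have := u_ge0 td; lra.
have mt := m_le_rank td Bt; rewrite -/c in mt.
apply: le_trans (lerD (lexx _) sumB) _.
rewrite natrB // -[j.+1]addn1 -[d.+1]addn1 !natrD.
have cjR : c%:R <= j%:R + 1 :> R by rewrite natr1 ler_nat.
have d0 : 0 <= d%:R :> R by [].
(* What remains holds because (d+1)(c-1)L + (j+1-c)dL falls short of (d+1)jL by (j+1-c)L. *)
have := ler_wpM2l (_ : 0 <= d%:R + 1 :> R) mt; rewrite addr_ge0 // => /(_ isT).
have := mulr_ge0 (_ : 0 <= j%:R + 1 - c%:R :> R) L0; rewrite subr_ge0 => /(_ cjR).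
nra.
Qed.

(** Sum [nonbasis_bound] over the d - j positions outside [B]. The sum of [u] over [B] is then
    subtracted d - j times, which leaves j + 1 of the d + 1 copies that come from [m] = [u] on
    [B]. *)
Lemma weighted_sum_rank_le :
  d.+1%:R * \sum_(t < d.+1) m t <=
  d.+1%:R * (j%:R * (d%:R - j%:R) * L) + j.+1%:R * \sum_(t < d.+1) u t.
Proof.
have cardBc : \sum_(t < d.+1 | ~~ B t) 1 = d%:R - j%:R :> R.
  have := congr1 (fun n => n%:R : R) cardB; rewrite natr_sum => sB.
  have : \sum_(t < d.+1) (1 : R) = d.+1%:R by rewrite sumr_const card_ord.
  rewrite (bigID (fun t : 'I__ => B t)) /= big_mkcond /=.
  rewrite (eq_bigr (fun t : 'I_d.+1 => (B t)%:R)); last by move=> t _; case: (B t).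
  rewrite sB -!natr1; lra.
have cB : \sum_(t < d.+1 | B t) 1 = j.+1%:R :> R.
  rewrite -cardB natr_sum big_mkcond; apply: eq_bigr => t _; by case: (B t).
set SB := \sum_(t < d.+1 | B t) u t.
have : \sum_(t < d.+1 | ~~ B t) (d.+1%:R * m t + \sum_(b < d.+1 | B b) (u b - u t))
   <= \sum_(t < d.+1 | ~~ B t) (d.+1%:R * (j%:R * L) * 1).
  by apply: ler_sum => t Bt; rewrite mulr1; apply: nonbasis_bound => //; rewrite -ltnS.
rewrite -mulr_sumr cardBc big_split /= -mulr_sumr.
under [X in _ + X]eq_bigr => t _.
  rewrite sumrB -/SB -[u t]mul1r -mulr_suml cB -[SB]mulr1; over.
rewrite sumrB -!mulr_sumr cardBc.
rewrite [\sum_(t < d.+1) m t](bigID (fun t : 'I__ => B t)) /=.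
rewrite [\sum_(t < d.+1) u t](bigID (fun t : 'I__ => B t)) /= -/SB.
have -> : \sum_(t < d.+1 | B t) m t = SB.
  by apply: eq_bigr => t; apply: mB; rewrite -ltnS.
rewrite -!natr1; set X := \sum_(t < d.+1 | ~~ B t) m t.
set Y := \sum_(t < d.+1 | ~~ B t) u t => H; nra.
Qed.

(* Interpolates between [k = j] and the trivial case [k = d]. *)
Lemma weighted_sum_le k : (j <= k < d)%N ->
  \sum_(t < d.+1) m t <=
  j%:R * (d - k)%N%:R * L + k.+1%:R / d.+1%:R * \sum_(t < d.+1) u t.
Proof.
move=> /andP[jk kd]; set X := \sum_(t < _) m t; set Y := \sum_(t < _) u t.
have XY : X <= Y by apply: ler_sum => t _; apply: m_le_u; rewrite -ltnS.
have := weighted_sum_rank_le; rewrite -/X -/Y => XZ.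
rewrite natrB ?(ltnW kd) //.
have jkR : 0 <= k%:R - j%:R :> R by rewrite subr_ge0 ler_nat.
have kdR : 0 <= d%:R - k%:R :> R by rewrite subr_ge0 ler_nat ltnW.
have djR : 0 < d%:R - j%:R :> R by rewrite subr_gt0 ltr_nat (leq_ltn_trans jk).
have d1 : 0 < d.+1%:R :> R by [].
rewrite -(ler_pM2l d1) -(ler_pM2l djR).
(* The weights d - k and k - j add up to d - j, and they give [Y] the right coefficient: (d-k)(j+1)
   + (k-j)(d+1) = (d-j)(k+1). *)
have := lerD (ler_wpM2l kdR XZ) (ler_wpM2l (mulr_ge0 jkR (ltW d1)) XY).
have -> : (d%:R - j%:R) * (d.+1%:R * (j%:R * (d%:R - k%:R) * L + k.+1%:R / d.+1%:R * Y)) =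
  (d%:R - j%:R) * (d.+1%:R * (j%:R * (d%:R - k%:R) * L) + k.+1%:R * Y).
  congr (_ * _); rewrite mulrDr; congr (_ + _).
  by rewrite mulrA [_ * (_ / _)]mulrCA divff ?gt_eqF // mulr1.
rewrite -!natr1; lra.
Qed.

End WeightedSums.

(** * Sums over tuples: last entries, rearrangements and powers of sums *)

Section TupleSums.
Variable T : finType.

Lemma sum_tuple_rcons (M : nmodType) n (G : seq T -> M) :
  \sum_(s : n.+1.-tuple T) G s =
  \sum_(s : n.-tuple T) \sum_x G (rcons s x).
Proof.
rewrite pair_big /=.
pose r (p : n.-tuple T * T) := [tuple of rcons p.1 p.2].
have r_inj : injective r.
  by move=> [s x] [s' x'] [/rcons_inj[/val_inj -> ->]].
have r_bij : bijective r.
  by apply: inj_card_bij => //; rewrite card_prod !card_tuple expnSr.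
by rewrite (reindex r) //; apply: onW_bij.
Qed.

(** [Phi s] is at most the sum of [Psi] over all rearrangements of [s], and each of the n!
    rearrangements is a bijection on tuples. This allows each tuple to be compared only in its
    sorted order. *)
Lemma sum_tuple_perm_le (R : numDomainType) n (Phi Psi : n.-tuple T -> R) :
  (forall s, 0 <= Psi s) ->
  (forall s, exists p : 'S_n, Phi s <= Psi [tuple tnth s (p i) | i < n]) ->
  \sum_s Phi s <= n`!%:R * \sum_s Psi s.
Proof.
move=> Psi0 PhiPsi.
pose a (p : 'S_n) (s : n.-tuple T) := [tuple tnth s (p i) | i < n].
have aK p : cancel (a p) (a p^-1%g).
  by move=> s; apply: eq_from_tnth => i; rewrite !tnth_mktuple permKV.
apply: le_trans (_ : \sum_s \sum_(p : 'S_n) Psi (a p s) <= _).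
  apply: ler_sum => s _; have [p /le_trans] := PhiPsi s; apply.
  by rewrite (bigD1 p) //= lerDl sumr_ge0.
rewrite exchange_big /= (eq_bigr (fun=> \sum_s Psi s)).
  by rewrite sumr_const card_Sn mulr_natl.
by move=> p _; rewrite [RHS](reindex_inj (can_inj (aK p))).
Qed.

Lemma exprn_sum_tuple (R : comPzSemiRingType) n (A : {pred T}) (f : T -> R) :
  (\sum_(x in A) f x) ^+ n =
  \sum_(s : n.-tuple T | all (mem A) s) \prod_(x <- s) f x.
Proof.
elim: n => [|n IHn].
  rewrite expr0 (eq_bigl xpredT) ?(big_pred1 [tuple]) ?big_nil //.
    by move=> s; apply/esym/eqP/tuple0.
  by move=> s; rewrite tuple0.
rewrite exprSr IHn [RHS]big_mkcond /=.
rewrite (sum_tuple_rcons n (fun s => if all (mem A) s then \prod_(x <- s) f x else 0)).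
rewrite mulr_suml big_mkcond /=; apply: eq_bigr => s _.
case: ifP => sA; last by rewrite big1 // => x _; rewrite all_rcons sA andbF.
rewrite mulr_sumr big_mkcond; apply: eq_bigr => x _.
by rewrite all_rcons sA andbT /= -cats1 big_cat big_seq1.
Qed.

End TupleSums.

(** * The weight W on tuples and its total mass *)

Section GreedyWeight.
Variables (R : realType) (F : finFieldType) (d : nat) (h : 'rV[F]_d -> R).
Implicit Types (s : seq 'rV[F]_d) (x y : 'rV[F]_d).

(* For [s = [::]] the second term adds a spurious, harmless unit mass at 0. *)
Definition step_weight s x : R :=
  h x + (x - head 0 s \in direction s)%:R * #|F|%:R ^- \dim (direction s).

Definition greedy_weight s : R :=
  \prod_(t < size s) step_weight (take t s) (nth 0 s t).

Lemma greedy_weight_rcons s x :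
  greedy_weight (rcons s x) = greedy_weight s * step_weight s x.
Proof.
rewrite /greedy_weight size_rcons big_ord_recr /=; congr (_ * _).
  apply: eq_bigr => t _.
  by rewrite nth_rcons ltn_ord -cats1 takel_cat // ltnW.
by rewrite nth_rcons ltnn eqxx -cats1 takel_cat // take_size.
Qed.

Hypothesis h_ge0 : forall x, 0 <= h x.

Lemma step_weight_ge0 s x : 0 <= step_weight s x.
Proof. by rewrite addr_ge0 // mulr_ge0 ?invr_ge0 ?exprn_ge0. Qed.

Lemma greedy_weight_ge0 s : 0 <= greedy_weight s.
Proof. by apply: prodr_ge0 => t _; apply: step_weight_ge0. Qed.

(** The second term puts q^-r on each of q^r points, so it has mass one whatever [s] is. *)
Lemma sum_step_weight s : \sum_x step_weight s x = \sum_x h x + 1.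
Proof.
rewrite big_split /= -mulr_suml; congr (_ + _).
rewrite -natr_sum -big_mkcond sum1dep_card card_affine natrX divff //.
by rewrite expf_neq0 // pnatr_eq0 -lt0n (ltnW (card_finRing_gt1 F)).
Qed.

(** Summing over the last entry first gives a factor independent of the earlier entries. *)
Lemma sum_greedy_weight n :
  \sum_(s : n.-tuple 'rV[F]_d) greedy_weight s = (\sum_x h x + 1) ^+ n.
Proof.
elim: n => [|n IHn].
  rewrite (big_pred1 [tuple]) /greedy_weight ?big_ord0 //.
  by move=> s; apply/esym/eqP/tuple0.
rewrite sum_tuple_rcons exprSr -IHn mulr_suml; apply: eq_bigr => s _.
rewrite -(sum_step_weight s) mulr_sumr; apply: eq_bigr => x _.
exact: greedy_weight_rcons.
Qed.

End GreedyWeight.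

(** * Comparison of the number of k-planes with W on sorted tuples *)

Section Greedy.
Variables (F : finFieldType) (d : nat).
Implicit Types (s : seq 'rV[F]_d).

(** The positions where the affine span grows. Position 0 is included by hand, since the first point
    minus itself is always a direction; a j-plane thus has j + 1 basis positions. *)
Definition in_greedy_basis s t : bool :=
  (t == 0%N) || (nth 0 s t - head 0 s \notin direction (take t s)).

Lemma card_greedy_basis s t : (0 < t <= size s)%N ->
  (\sum_(b < t) in_greedy_basis s b = (\dim (direction (take t s))).+1)%N.
Proof.
case/andP; elim: t => // t IHt _ ts.
rewrite big_ord_recr /= (take_nth 0) //.
have [->|t0] := posnP t.
  by rewrite big_ord0 take0 /= direction1 dimv0.
have tks0 : take t s != [::] by rewrite -size_eq0 size_take ts -lt0n.
have htake : head 0 (take t s) = head 0 s by case: s ts tks0 {IHt}; case: t t0.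
rewrite IHt ?(ltnW ts) // dim_direction_rcons // htake.
by rewrite /in_greedy_basis gtn_eqF // addSn.
Qed.

Variables (R : realType) (k : nat) (h : 'rV[F]_d -> R).
Local Notation q := (#|F|%:R : R).
Hypothesis h_ge : forall x, q ^- d <= h x.
Hypothesis h_le1 : forall x, h x <= 1.
Hypothesis kd : (k < d)%N.

(** In logarithms this is [weighted_sum_le]: the left-hand side is exp(-(k+1)/(d+1) sum u), W is at
    least exp(- sum m), and the power of q absorbs the term j(d-k)L. *)
Lemma prod_powR_le_greedy_weight s : size s = d.+1 ->
  sorted (fun x y => h y <= h x) s -> (\dim (direction s) <= k)%N ->
  \prod_(x <- s) h x `^ (k.+1%:R / d.+1%:R) <=
  q ^+ (\dim (direction s) * (d - k)) * greedy_weight h s.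
Proof.
move=> ss hs jk; set j := \dim _ in jk *.
have q1 : 1 < q by rewrite ltr1n card_finRing_gt1.
have q0 : 0 < q by apply: lt_trans q1.
have h0 x : 0 < h x by apply: lt_le_trans (h_ge x); rewrite invr_gt0 exprn_gt0.
pose L := ln q; pose u t := - ln (h (nth 0 s t)).
pose r t := \dim (direction (take t s)).
pose m t := if in_greedy_basis s t then u t else Num.min (u t) ((r t)%:R * L).
have L0 : 0 <= L by rewrite ln_ge0 // ltW.
have expL n : expR (n%:R * L) = q ^+ n.
  by rewrite expRM_natl lnK.
have expu t : expR (- u t) = h (nth 0 s t) by rewrite opprK lnK // posrE.
have cardB : (\sum_(t < d.+1) in_greedy_basis s t = j.+1)%N.
  by rewrite card_greedy_basis ?ss ?leqnn // -ss take_size.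
have key : \sum_(t < d.+1) m t <= j%:R * (d - k)%N%:R * L +
    k.+1%:R / d.+1%:R * \sum_(t < d.+1) u t.
  apply: (weighted_sum_le (B := in_greedy_basis s)) => //.
  - by move=> t _; rewrite oppr_ge0 ln_le0.
  (* The upper bound [u t] <= dL is the lower bound q^-d on [h]. *)
  - move=> t _; rewrite -ler_expR expL -[u t]opprK expRN expu.
    by rewrite -[leRHS]invrK lef_pV2 // posrE ?invr_gt0 ?exprn_gt0.
  - move=> b t /andP[bt td]; rewrite lerN2 ler_ln ?posrE //.
    apply: (sorted_leq_nth _ _ 0 hs) => //; rewrite ?inE ?ss ?ltnS //.
    + by move=> y x z yx zy; apply: le_trans zy yx.
    + exact: leq_trans bt td.
  - by move=> t _ tB; rewrite /m tB.
  - by move=> t _; rewrite /m; case: ifP => // _; rewrite ge_min lexx.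
  (* The basis positions before [t] number [r t] + 1, whence the extra [L] on the left. *)
  - move=> t td tB; have t0 : (0 < t)%N by move: tB; case: t {td}.
    rewrite /m (negbTE tB) card_greedy_basis ?t0 ?ss ?leqW //.
    by rewrite -natr1 mulrDl mul1r lerD2r ge_min lexx orbT.
  - by rewrite jk.
(* At a basis position exp(- m) is the term h of the step weight; elsewhere it is the larger of the
   two terms, hence at most their sum. *)
have wm (t : 'I_d.+1) : expR (- m t) <= step_weight h (take t s) (nth 0 s t).
  rewrite /m /step_weight; case: ifPn => [_|].
    by rewrite expu lerDl mulr_ge0 // invr_ge0 exprn_ge0 // ltW.
  rewrite negb_or negbK => /andP[t0 tD].
  have htake : head 0 (take t s) = head 0 s.
    by case: (nat_of_ord t) t0 => // t' _; case: (s).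
  rewrite htake tD mul1r -/(r t) -expL -expRN oppr_min.
  case: (leP (- u t) (- ((r t)%:R * L))) => _; last by rewrite expu lerDl expR_ge0.
  by rewrite lerDr ltW.
have prodE : \prod_(x <- s) h x `^ (k.+1%:R / d.+1%:R) =
    expR (- (k.+1%:R / d.+1%:R * \sum_(t < d.+1) u t)).
  rewrite (big_nth 0) ss big_mkord mulr_sumr -sumrN expR_sum.
  apply: eq_bigr => t _; rewrite /powR gt_eqF //; congr expR.
  by rewrite mulrN opprK.
have weightE : expR (- \sum_(t < d.+1) m t) <= greedy_weight h s.
  rewrite -sumrN expR_sum /greedy_weight ss; apply: ler_prod => t _.
  by rewrite expR_ge0 wm.
rewrite prodE; apply: le_trans (ler_wpM2l _ weightE); last by rewrite exprn_ge0 ?ltW.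
by rewrite -expL -expRD ler_expR natrM lerBrDr addrC lerBlDr.
Qed.

(** If j > k there is no k-plane through [s]. Otherwise the exponents (d-k)(k-j) from the count and
    j(d-k) from the product add up to (d-k)k, free of j. *)
Lemma kplanes_on_prod_le s : size s = d.+1 ->
  sorted (fun x y => h y <= h x) s ->
  #|kplanes_on k s|%:R * \prod_(x <- s) h x `^ (k.+1%:R / d.+1%:R) <=
  2 ^+ k * q ^+ ((d - k) * k) * greedy_weight h s.
Proof.
move=> ss hs; have s0 : s != [::] by rewrite -size_eq0 ss.
have q1 : 1 < q by rewrite ltr1n card_finRing_gt1.
have q0 : 0 < q by apply: lt_trans q1.
have W0 : 0 <= greedy_weight h s.
  apply: greedy_weight_ge0 => x; apply: le_trans (h_ge x).
  by rewrite invr_ge0 exprn_ge0 // ltW.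
set j := \dim (direction s).
have [kj|jk] := ltnP k j.
  by rewrite kplanes_on_eq0 // mul0r !mulr_ge0 ?exprn_ge0 // ltW.
have N_le : #|kplanes_on k s|%:R <= 2 ^+ k * q ^+ ((d - k) * (k - j)).
  apply: le_trans (_ : ((2 * #|F| ^ (d - k)) ^ (k - j))%N%:R <= _).
    by rewrite ler_nat kplanes_on_upper ?subnKC // ltnW.
  rewrite natrX natrM natrX exprMn -exprM ler_wpM2r ?exprn_ge0 ?(ltW q0) //.
  by rewrite ler_weXn2l ?leq_subr // ler1n.
apply: le_trans (ler_pM _ _ N_le (prod_powR_le_greedy_weight ss hs jk)) _ => //.
  by apply: prodr_ge0 => x _; apply: powR_ge0.
rewrite -/j mulrA ler_wpM2r // -!mulrA -exprD.
by rewrite [(j * _)%N]mulnC -mulnDr subnK.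
Qed.

End Greedy.

(** * The complex modulus: integers, positivity and the triangle inequality *)

Lemma normc_nat (R : rcfType) n : Normc.normc (n%:R : R[i]) = n%:R.
Proof. by rewrite (normcMn (1 : R[i])) Normc.normc1. Qed.

Lemma normc_ge0 (R : rcfType) (z : R[i]) : 0 <= Normc.normc z.
Proof. by case: z => a b; apply: sqrtr_ge0. Qed.

Lemma normc_sum_le (R : rcfType) (T : finType) (A : {pred T}) (f : T -> R[i]) :
  Normc.normc (\sum_(x in A) f x) <= \sum_(x in A) Normc.normc (f x).
Proof.
elim/big_ind2: _ => [|z a y b zy ab|//]; first by rewrite Normc.normc0.
exact: le_trans (le_normcD _ _) (lerD zy ab).
Qed.

(** * The estimate for normalized densities h *)

Section KPlaneEstimate.
Variables (R : realType) (F : finFieldType) (d k : nat).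
Hypothesis kd : (k < d)%N.
Local Notation q := (#|F|%:R : R).

(** Expanding the power and exchanging sums produces N(s). The factor (d+1)! pays for sorting the
    tuples, 2^k for the bound on N(s), and 3^(d+1) for the mass of W, as sum h + 1 <= 3. *)
Lemma sum_kplane_powR_le (h : 'rV[F]_d -> R) :
  (forall x, q ^- d <= h x) -> (forall x, h x <= 1) -> \sum_x h x <= 2 ->
  \sum_(w : kplane F d k)
    (\sum_(x in val w) h x `^ (k.+1%:R / d.+1%:R)) ^+ d.+1 <=
  (d.+1)`!%:R * 2 ^+ k * 3 ^+ d.+1 * q ^+ ((d - k) * k).
Proof.
move=> h_ge h_le1 sum_h.
have q0 : 0 < q by rewrite ltr0n (ltnW (card_finRing_gt1 F)).
have h0 x : 0 <= h x by apply: le_trans (h_ge x); rewrite invr_ge0 exprn_ge0 // ltW.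
pose Phi (s : seq 'rV[F]_d) : R :=
  #|kplanes_on k s|%:R * \prod_(x <- s) h x `^ (k.+1%:R / d.+1%:R).
pose Psi s : R := 2 ^+ k * q ^+ ((d - k) * k) * greedy_weight h s.
have Psi0 s : 0 <= Psi s by rewrite !mulr_ge0 ?exprn_ge0 ?greedy_weight_ge0 // ltW.
have -> : \sum_(w : kplane F d k)
    (\sum_(x in val w) h x `^ (k.+1%:R / d.+1%:R)) ^+ d.+1 =
    \sum_(s : d.+1.-tuple 'rV[F]_d) Phi s.
  under eq_bigr do rewrite exprn_sum_tuple.
  rewrite (exchange_big_dep xpredT) //=; apply: eq_bigr => s _.
  rewrite sumr_const /Phi [RHS]mulr_natl; congr (_ *+ _).
  by apply: eq_card => w; rewrite !inE.
apply: le_trans (sum_tuple_perm_le (Psi := Psi) _ _) _ => // [s|].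
  (* [Phi] does not depend on the order of the entries while [Psi] does, so the permutation is
     chosen to sort [s] by decreasing [h]. *)
  pose leh x y := h y <= h x.
  have /tuple_permP[p sE] : perm_eq (sort leh s) s by rewrite perm_sort.
  exists p; rewrite -sE.
  have -> : Phi s = Phi (sort leh s).
    have ss : perm_eq s (sort leh s) by rewrite perm_sym perm_sort.
    rewrite /Phi (perm_big _ ss); congr (_%:R * _).
    by apply: eq_card => w; rewrite !inE (perm_all _ ss).
  apply: kplanes_on_prod_le => //; first by rewrite size_sort size_tuple.
  by apply: sort_sorted => x y; apply: le_total.
rewrite -mulr_sumr sum_greedy_weight -!mulrA ler_wpM2l // ler_wpM2l ?exprn_ge0 //.
rewrite mulrC ler_wpM2r ?exprn_ge0 ?(ltW q0) //.
by rewrite lerXn2r ?nnegrE ?addr_ge0 ?sumr_ge0 //; lra.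
Qed.

End KPlaneEstimate.

(** * Reduction of the norm inequality to densities *)

Local Open Scope complex_scope.

Theorem theorem1p2 (R : realType) (d k : nat)
    (hd : (2 <= d)%N) (hk : (1 <= k <= d - 1)%N) :
  exists C : R, 0 < C /\
    forall (F : finFieldType) (f : 'rV[F]_d -> R[i]),
      Lpnorm (d.+1)%:R (@kplane_transform R F d k f)
        <= C * Lpnorm ((d.+1)%:R / (k.+1)%:R) f.
Proof.
have kd : (k < d)%N by lia.
pose K : R := (d.+1)`!%:R * 2 ^+ k * 3 ^+ d.+1.
have K0 : 0 < K by rewrite !mulr_gt0 ?exprn_gt0 // ltr0n fact_gt0.
exists (K `^ d.+1%:R^-1); split=> [|F f]; first exact: powR_gt0.
pose q : R := #|F|%:R.
have q0 : 0 < q by rewrite ltr0n (ltnW (card_finRing_gt1 F)).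
have qn_neq0 n : q ^+ n != 0 by rewrite expf_neq0 // gt_eqF.
have cardV : #|'rV[F]_d|%:R = q ^+ d by rewrite card_mx mul1n natrX.
set p : R := d.+1%:R / k.+1%:R.
pose alpha : R := k.+1%:R / d.+1%:R.
have pV : p^-1 = alpha by rewrite invf_div.
have p_gt0 : 0 < p by rewrite divr_gt0.
have alpha0 : 0 <= alpha by rewrite divr_ge0.
pose A : R := \sum_x Normc.normc (f x) `^ p.
have A0 : 0 <= A by apply: sumr_ge0 => x _; apply: powR_ge0.
have fA x : Normc.normc (f x) `^ p <= A.
  by rewrite /A (bigD1 x) //= lerDl sumr_ge0 // => y _; apply: powR_ge0.
(* |f|^p is normalized to total mass at most 1; raising it to q^-d adds at most q^d q^-d = 1. If [A]
   = 0, the quotient is 0 by convention and [h] is constantly q^-d. *)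
pose h x := Num.max (Normc.normc (f x) `^ p / A) (q ^- d).
have h_ge x : q ^- d <= h x by rewrite le_max lexx orbT.
have h_le1 x : h x <= 1.
  rewrite ge_max; apply/andP; split.
    have [->|A_neq0] := eqVneq A 0; first by rewrite invr0 mulr0.
    by rewrite ler_pdivrMr ?mul1r // lt_def A_neq0.
  by rewrite invf_le1 ?exprn_gt0 // exprn_ege1 // ler1n (ltnW (card_finRing_gt1 F)).
have sum_h : \sum_x h x <= 2.
  apply: le_trans (_ : \sum_x (Normc.normc (f x) `^ p / A + q ^- d) <= _).
    apply: ler_sum => x _; rewrite ge_max lerDl lerDr.
    by rewrite invr_ge0 exprn_ge0 ?(ltW q0) //= divr_ge0 // powR_ge0.
  rewrite big_split /= -mulr_suml -/A sumr_const -[_ *+ #|_|]mulr_natl cardV.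
  rewrite (divff (qn_neq0 d)) -[leRHS]/(1 + 1) lerD2r.
  by have [->|A_neq0] := eqVneq A 0; rewrite ?invr0 ?mulr0 // divff.
(* Since |f|^p <= A h and [alpha] = 1/p, this is the p-th root. *)
have f_le x : Normc.normc (f x) <= A `^ alpha * h x `^ alpha.
  have h0 : 0 <= h x by apply: le_trans (h_ge x); rewrite invr_ge0 exprn_ge0 ?ltW.
  rewrite -powRM // -[leLHS]powRr1 ?normc_ge0 //.
  rewrite -(divff (lt0r_neq0 p_gt0)) powRrM pV.
  apply: ge0_ler_powR; rewrite ?nnegrE ?powR_ge0 ?(mulr_ge0 A0 h0) //.
  have [Az|A_neq0] := eqVneq A 0; first by rewrite Az mul0r -Az fA.
  by rewrite mulrC -ler_pdivrMr ?le_max ?lexx // lt_def A_neq0.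
have Tf_le (w : kplane F d k) : Normc.normc (kplane_transform f w) <=
    q ^- k * (A `^ alpha * \sum_(x in val w) h x `^ alpha).
  rewrite /kplane_transform Normc.normcM Normc.normcV normc_nat card_kplane_on natrX.
  rewrite ler_wpM2l ?invr_ge0 ?exprn_ge0 ?(ltW q0) //.
  apply: le_trans (normc_sum_le _ _) _; rewrite mulr_sumr.
  by apply: ler_sum => x _.
have A_pow : (A `^ alpha) ^+ d.+1 = A ^+ k.+1.
  by rewrite -powR_mulrn ?powR_ge0 // -powRrM divfK ?pnatr_eq0 // powR_mulrn.
have qA0 : 0 <= q ^- d * A by rewrite mulr_ge0 // invr_ge0 exprn_ge0 // ltW.
have KA0 : 0 <= K * (q ^- d * A) ^+ k.+1.
  by rewrite mulr_ge0 ?exprn_ge0 // ltW.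
rewrite /Lpnorm pV cardV -/A -/alpha.
have M_ge : q ^+ ((d - k) * k.+1) <= #|{: kplane F d k}|%:R.
  by rewrite -natrX ler_nat card_kplane_lower // ltnW.
have M0 : 0 < #|{: kplane F d k}|%:R :> R by apply: lt_le_trans M_ge; rewrite exprn_gt0.
have inner : #|{: kplane F d k}|%:R^-1 *
    \sum_(w : kplane F d k) Normc.normc (kplane_transform f w) `^ d.+1%:R <=
    K * (q ^- d * A) ^+ k.+1.
  rewrite mulrC ler_pdivrMr //.
  apply: le_trans (_ : K * (q ^- d * A) ^+ k.+1 * q ^+ ((d - k) * k.+1) <= _); last first.
    exact: ler_wpM2l KA0 _ _ M_ge.
  have -> : K * (q ^- d * A) ^+ k.+1 * q ^+ ((d - k) * k.+1) =
      q ^- (k * d.+1) * A ^+ k.+1 * (K * q ^+ ((d - k) * k)).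
    (* Both sides are q^(-k(k+1)); the denominators are cleared so that only natural exponents are
       compared. *)
    have qE : q ^- (d * k.+1) * q ^+ ((d - k) * k.+1) =
              q ^- (k * d.+1) * q ^+ ((d - k) * k).
      apply: (mulfI (qn_neq0 (d * k.+1 + k * d.+1)%N)).
      rewrite {1}addnC !exprD !mulrA mulfK //.
      rewrite [q ^+ (k * _) * _]mulrC mulrK ?unitfE //.
      by rewrite -!exprD; congr (_ ^+ _); nia.
    rewrite exprMn exprVn -exprM -!mulrA [A ^+ _ * q ^+ _]mulrC.
    by rewrite [q ^- _ * (q ^+ _ * _)]mulrA qE; ring.
  apply: le_trans (ler_wpM2l _ (sum_kplane_powR_le kd h_ge h_le1 sum_h)).
    rewrite mulr_sumr; apply: ler_sum => w _.
    rewrite powR_mulrn ?normc_ge0 //.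
    apply: le_trans (_ : (q ^- k * (A `^ alpha * \sum_(x in val w) h x `^ alpha)) ^+ d.+1 <= _).
      by rewrite lerXn2r ?nnegrE ?normc_ge0 // (le_trans (normc_ge0 _) (Tf_le w)).
    by rewrite !exprMn A_pow exprVn -exprM mulrA.
  by rewrite mulr_ge0 ?exprn_ge0 // invr_ge0 exprn_ge0 // ltW.
apply: le_trans (ge0_ler_powR _ _ _ inner) _.
- by rewrite invr_ge0.
- rewrite nnegrE mulr_ge0 ?invr_ge0 ?sumr_ge0 // => w _; exact: powR_ge0.
- by rewrite nnegrE.
(* The (d+1)-th root turns the exponent k + 1 of q^-d [A] into [alpha], which gives the norm of
   [f]. *)
rewrite powRM ?exprn_ge0 ?(ltW K0) // ler_wpM2l ?powR_ge0 //.
by rewrite -(powR_mulrn _ qA0) -powRrM.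
Qed.
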